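(* Let $U=\begin{pmatrix} A_{U} & B_{U}\\ C_{U} & D_{U}\end{pmatrix}$ and $V=\begin{pmatrix} A_{V} & B_{V}\\ C_{V} & D_{V}\end{pmatrix}$ be complex block matrices of the same size, partitioned in the same way, with $A_U,A_V\in\mathbb{C}^{m\times n}$, $B_U,B_V\in\mathbb{C}^{m\times p}$, $C_U,C_V\in\mathbb{C}^{s\times n}$, $D_U,D_V\in\mathbb{C}^{s\times p}$. Let $G_{U}=A_{U}-B_{U}D_{U}^\dagger C_{U}$ and $G_{V}=A_{V}-B_{V}D_{V}^\dagger C_{V}$. Suppose that $R(C_{U})\subseteq R(D_{U})$, $R((D_{U}^\dagger C_{U})^* )\subseteq R(G_{U}^* )$, $R(B_{V}^* )\subseteq R(D_{V}^* )$ and $R(B_{V}D_{V}^\dagger)\subseteq R(G_{V})$. If $(U,V)$ is a Moore-Penrose inverse absorbing pair, then $(G_{U},G_{V})$ is also a Moore-Penrose inverse absorbing pair.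
   Context: $R(X)$ denotes the range (column space) of a matrix $X$ and $X^*$ its conjugate transpose. $X^\dagger$ denotes the Moore-Penrose inverse of $X$, i.e. the unique matrix $Y$ with $XYX=X$, $YXY=Y$, $(XY)^*=XY$, $(YX)^*=YX$. For complex matrices $P,Q$ of the same size, the pair $(P,Q)$ is called a Moore-Penrose inverse absorbing pair if $P^\dagger+Q^\dagger=P^\dagger(P+Q)Q^\dagger$. *)

(* Defs.v *)
From HB Require Import structures.
From mathcomp Require Import all_boot all_order all_algebra.
From mathcomp Require Import complex reals.

Set Implicit Arguments.
Unset Strict Implicit.
Unset Printing Implicit Defensive.

Import Order.TTheory GRing.Theory Num.Theory.
Local Open Scope ring_scope.
Local Open Scope sesquilinear_scope.

(* R(X) is a column space whereas %MS compares row spaces, hence the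
   transposes; [range_subP] is the set-theoretic inclusion of ranges. *)
Definition range_sub (C : numClosedFieldType) (m n p : nat)
    (X : 'M[C]_(m, n)) (Y : 'M[C]_(m, p)) : bool :=
  (X^T <= Y^T)%MS.

Lemma range_subP (C : numClosedFieldType) (m n p : nat)
    (X : 'M[C]_(m, n)) (Y : 'M[C]_(m, p)) :
  reflect (forall x : 'cV[C]_n, exists y : 'cV[C]_p, X *m x = Y *m y)
          (range_sub X Y).
Proof.
apply: (iffP idP) => [/submxP[D eqX] x | sXY].
  exists (D^T *m x).
  by rewrite -[X]trmxK eqX trmx_mul trmxK mulmxA.
apply/row_subP => i; have [y eqy] := sXY (delta_mx i 0).
apply/submxP; exists y^T.
by rewrite -trmx_mul -eqy -colE tr_col.
Qed.

Definition is_mpinv (C : numClosedFieldType) (m n : nat)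
    (X : 'M[C]_(m, n)) (Y : 'M[C]_(n, m)) : bool :=
  [&& X *m Y *m X == X, Y *m X *m Y == Y,
      (X *m Y) ^t* == X *m Y & (Y *m X) ^t* == Y *m X].

Lemma trmxC_mul (C : numClosedFieldType) (m n p : nat)
    (A : 'M[C]_(m, n)) (B : 'M[C]_(n, p)) : (A *m B) ^t* = B ^t* *m A ^t*.
Proof. by rewrite trmx_mul map_mxM. Qed.

Lemma is_mpinv_unique (C : numClosedFieldType) (m n : nat)
    (X : 'M[C]_(m, n)) (Y Z : 'M[C]_(n, m)) :
  is_mpinv X Y -> is_mpinv X Z -> Y = Z.
Proof.
case/and4P=> /eqP y1 /eqP y2 /eqP y3 /eqP y4.
case/and4P=> /eqP z1 /eqP z2 /eqP z3 /eqP z4.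
have eqL : X *m Y = X *m Z.
  by rewrite -y3 -[in LHS]z1 -(mulmxA (X *m Z)) trmxC_mul y3 z3 mulmxA y1.
have eqR : Y *m X = Z *m X.
  by rewrite -y4 -[in LHS]z1 -(mulmxA X) mulmxA trmxC_mul y4 z4 -mulmxA
     (mulmxA X) y1.
by rewrite -y2 eqR -mulmxA eqL mulmxA z2.
Qed.

Lemma gram_unit (C : numClosedFieldType) (r n : nat) (F : 'M[C]_(r, n)) :
  row_free F -> F *m F ^t* \in unitmx.
Proof.
move=> freeF; rewrite -row_free_unit -kermx_eq0; apply/rowV0P => u.
move/sub_kermxP; rewrite mulmxA => uG0.
have : dotmx (u *m F) (u *m F) = 0.
  by rewrite dotmxE trmxC_mul mulmxA uG0 mul0mx mxE.
move/eqP; rewrite dnorm_eq0 => /eqP uF0.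
by apply/eqP; rewrite -(mulmx_free_eq0 _ freeF) uF0.
Qed.

Lemma mpinv_exists (C : numClosedFieldType) (m n : nat) (X : 'M[C]_(m, n)) :
  exists Y, is_mpinv X Y.
Proof.
have defX : X = col_base X *m row_base X by rewrite mulmx_base.
have uF := gram_unit (row_base_free X).
have uE : (col_base X) ^t* *m col_base X \in unitmx.
  rewrite -[col_base X in X in _ *m X]trmxCK; apply: gram_unit.
  by rewrite row_free_map /row_free mxrank_tr -/(row_full _) col_base_full.
move: (\rank X) (col_base X) (row_base X) defX uF uE => r E F -> uF uE.
have hermV k (G : 'M[C]_k) : G ^t* = G -> (invmx G) ^t* = invmx G.
  by move=> hG; rewrite trmx_inv map_invmx hG.
have hF : (F *m F ^t*) ^t* = F *m F ^t* by rewrite trmxC_mul trmxCK.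
have hE : (E ^t* *m E) ^t* = E ^t* *m E by rewrite trmxC_mul trmxCK.
pose Y := F ^t* *m invmx (F *m F ^t*) *m (invmx (E ^t* *m E) *m E ^t*).
have XY : E *m F *m Y = E *m invmx (E ^t* *m E) *m E ^t*.
  by rewrite /Y -!mulmxA; congr (E *m _); rewrite !mulmxA mulmxV // mul1mx.
have YX : Y *m (E *m F) = F ^t* *m invmx (F *m F ^t*) *m F.
  rewrite /Y -!mulmxA; do 2!congr (_ *m _).
  by rewrite (mulmxA _ E F) mulmxA mulVmx // mul1mx.
exists Y; apply/and4P; split; apply/eqP.
- by rewrite XY -!mulmxA (mulmxA _ E F) (mulmxA (invmx _)) mulVmx // mul1mx.
- rewrite YX /Y -!mulmxA; congr (_ *m (_ *m _)).
  by rewrite (mulmxA F) mulmxA mulmxV // mul1mx.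
- by rewrite XY !trmxC_mul trmxCK hermV // mulmxA.
- by rewrite YX !trmxC_mul trmxCK hermV // mulmxA.
Qed.

Definition mpinv (C : numClosedFieldType) (m n : nat)
    (X : 'M[C]_(m, n)) : 'M[C]_(n, m) :=
  xchoose (mpinv_exists X).

Lemma mpinvP (C : numClosedFieldType) (m n : nat) (X : 'M[C]_(m, n)) :
  is_mpinv X (mpinv X).
Proof. exact: xchooseP. Qed.

Definition mp_absorbing (C : numClosedFieldType) (m n : nat)
    (P Q : 'M[C]_(m, n)) : Prop :=
  mpinv P + mpinv Q = mpinv P *m (P + Q) *m mpinv Q.

(* Main.v *)
(* (P, Q) is an absorbing pair iff R(P) <= R(Q) and R(Q^* ) <= R(P^* ).
   If C = D X and the rows of X lie in the row space of G = A - B X, then so do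
   those of A = G + B X and of C, hence those of A' and C' whenever the row
   space of (A' B'; C' D') is contained in that of (A B; C D).  This gives the
   inclusion of the row spaces of the Schur complements, and the inclusion of
   their column spaces is the same fact for the transposes. *)

Require Import Defs.
From HB Require Import structures.
From mathcomp Require Import all_boot all_order all_algebra.
From mathcomp Require Import complex reals.

Set Implicit Arguments.
Unset Strict Implicit.
Unset Printing Implicit Defensive.

Import Order.TTheory GRing.Theory Num.Theory.
Local Open Scope ring_scope.
Local Open Scope sesquilinear_scope.

Section SchurRowSpace.
Variables (F : fieldType) (m n p s : nat).

(** Leaving [Y] arbitrary lets one statement serve both inclusions: [X] comes from the larger
    complement, [Y] from the smaller one, and transposition swaps these roles. *)
Lemma submx_schur (A A' : 'M[F]_(m, n)) (B B' : 'M[F]_(m, p))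
    (C C' : 'M[F]_(s, n)) (D D' : 'M[F]_(s, p))
    (X : 'M[F]_(p, n)) (Y : 'M[F]_(m, s)) :
  (block_mx A' B' C' D' <= block_mx A B C D)%MS ->
  C = D *m X -> (X <= A - B *m X)%MS ->
  (A' - Y *m C' <= A - B *m X)%MS.
Proof.
move=> /submxP[W]; rewrite -[W]submxK mulmx_block.
case/eq_block_mx=> eqA _ eqC _ defC sXG.
have sMX k (M : 'M_(k, p)) : (M *m X <= A - B *m X)%MS.
  exact: submx_trans (submxMl _ _) sXG.
have sA : (A <= A - B *m X)%MS.
  by rewrite -{1}[A](subrK (B *m X)) addmx_sub.
have sAC k (M : 'M_(k, m)) (N : 'M_(k, s)) :
    ((M *m A + N *m C)%R <= A - B *m X)%MS.
  by rewrite addmx_sub ?mulmx_sub // defC mulmx_sub.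
by rewrite eqA eqC addmx_sub ?sAC // eqmx_opp mulmx_sub ?sAC.
Qed.

End SchurRowSpace.

Section AbsorbingPairs.
Variable K : numClosedFieldType.

(** After the plain transpose in [range_sub], only entrywise conjugation is left, and a field
    morphism preserves and reflects inclusion of row spaces. *)
Lemma range_sub_trmxC (m n p : nat) (X : 'M[K]_(m, n)) (Y : 'M[K]_(p, n)) :
  range_sub (X ^t*) (Y ^t*) = (X <= Y)%MS.
Proof. by rewrite /range_sub !map_trmx !trmxK map_submx. Qed.

Lemma mpinvK (m n : nat) (X : 'M[K]_(m, n)) : X *m mpinv X *m X = X.
Proof. by case/and4P: (mpinvP X) => /eqP. Qed.

Lemma mpinvKV (m n : nat) (X : 'M[K]_(m, n)) :
  mpinv X *m X *m mpinv X = mpinv X.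
Proof. by case/and4P: (mpinvP X) => _ /eqP. Qed.

Lemma mulmx_mpinv_herm (m n : nat) (X : 'M[K]_(m, n)) :
  (X *m mpinv X) ^t* = X *m mpinv X.
Proof. by case/and4P: (mpinvP X) => _ _ /eqP. Qed.

Lemma mulmpinv_mx_herm (m n : nat) (X : 'M[K]_(m, n)) :
  (mpinv X *m X) ^t* = mpinv X *m X.
Proof. by case/and4P: (mpinvP X) => _ _ _ /eqP. Qed.

Lemma submx_mpinvP (m n p : nat) (X : 'M[K]_(m, n)) (Y : 'M[K]_(p, n)) :
  reflect (X *m (mpinv Y *m Y) = X) (X <= Y)%MS.
Proof.
apply: (iffP submxP) => [[W ->] | <-]; first by rewrite -mulmxA (mulmxA Y) mpinvK.
by exists (X *m mpinv Y); rewrite mulmxA.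
Qed.

Lemma range_sub_mpinvP (m n p : nat) (X : 'M[K]_(m, n)) (Y : 'M[K]_(m, p)) :
  reflect (Y *m mpinv Y *m X = X) (range_sub X Y).
Proof.
apply: (iffP submxP) => [[W /(canRL (@trmxK _ _ _)) ->] | <-].
  by rewrite trmx_mul trmxK mulmxA mpinvK.
by exists (mpinv Y *m X)^T; rewrite -trmx_mul mulmxA.
Qed.

(** Both sides say that the Hermitian projection [X *m mpinv X] absorbs [H], on the right or on the
    left; taking adjoints exchanges the two. *)
Lemma mulmpinv_herm (m n : nat) (X : 'M[K]_(m, n)) (H : 'M[K]_m) :
  H ^t* = H -> mpinv X *m H = mpinv X <-> H *m X = X.
Proof.
move=> hermH; split=> eqH.
  have eqHX : H *m (X *m mpinv X) = X *m mpinv X.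
    by rewrite -mulmx_mpinv_herm -{1}hermH -trmxC_mul -mulmxA eqH.
  by rewrite -{1}[X]mpinvK mulmxA eqHX mpinvK.
have eqXH : X *m mpinv X *m H = X *m mpinv X.
  by rewrite -{1}mulmx_mpinv_herm -{1}hermH -trmxC_mul mulmxA eqH mulmx_mpinv_herm.
by rewrite -{1}[mpinv X]mpinvKV -!mulmxA (mulmxA X) eqXH mulmxA mpinvKV.
Qed.

Lemma mulherm_mpinv (m n : nat) (X : 'M[K]_(m, n)) (H : 'M[K]_n) :
  H ^t* = H -> H *m mpinv X = mpinv X <-> X *m H = X.
Proof.
move=> hermH; split=> eqH.
  have eqXH : mpinv X *m X *m H = mpinv X *m X.
    rewrite -{1}mulmpinv_mx_herm -{1}hermH -trmxC_mul mulmxA eqH.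
    exact: mulmpinv_mx_herm.
  by rewrite -{1}[X]mpinvK -!mulmxA (mulmxA (mpinv X)) eqXH mulmxA mpinvK.
have eqHX : H *m (mpinv X *m X) = mpinv X *m X.
  by rewrite -mulmpinv_mx_herm -{1}hermH -trmxC_mul -mulmxA eqH.
by rewrite -{1}[mpinv X]mpinvKV mulmxA eqHX mpinvKV.
Qed.

Lemma mp_absorbingP (m n : nat) (P Q : 'M[K]_(m, n)) :
  mp_absorbing P Q <-> range_sub P Q /\ (Q <= P)%MS.
Proof.
have -> : mp_absorbing P Q <->
    mpinv P *m (Q *m mpinv Q) = mpinv P /\ mpinv P *m P *m mpinv Q = mpinv Q.
  rewrite /mp_absorbing mulmxDr mulmxDl -(mulmxA _ Q); split=> [absPQ | [-> ->]].
    (* multiplying on the left by the projection P^+ P kills the P^+ terms *)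
    have eqP : mpinv P *m (Q *m mpinv Q) = mpinv P.
      move/(congr1 (mulmx (mpinv P *m P))): absPQ.
      by rewrite !mulmxDr !mulmxA !mpinvKV addrC => /addrI.
    by split=> //; move: absPQ; rewrite eqP addrC => /addIr.
  exact: addrC.
(* With [H] the orthogonal projection onto the range of [Q], then onto that of the adjoint of [P],
   the conditions on pseudoinverses become conditions on [P] and [Q]. *)
rewrite (mulmpinv_herm _ (mulmx_mpinv_herm Q)).
rewrite (mulherm_mpinv _ (mulmpinv_mx_herm P)).
by split=> -[/range_sub_mpinvP sPQ /submx_mpinvP sQP].
Qed.

Lemma mp_absorbing_schur (m n p s : nat) (AU AV : 'M[K]_(m, n))
    (BU BV : 'M[K]_(m, p)) (CU CV : 'M[K]_(s, n)) (DU DV : 'M[K]_(s, p)) :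
  let GU := AU - BU *m mpinv DU *m CU in
  let GV := AV - BV *m mpinv DV *m CV in
  range_sub CU DU ->
  range_sub ((mpinv DU *m CU) ^t*) (GU ^t*) ->
  range_sub (BV ^t*) (DV ^t*) ->
  range_sub (BV *m mpinv DV) GV ->
  mp_absorbing (block_mx AU BU CU DU) (block_mx AV BV CV DV) ->
  mp_absorbing GU GV.
Proof.
move=> GU GV /range_sub_mpinvP sCD; rewrite !range_sub_trmxC => sXG.
move=> /submx_mpinvP sBD sYG /mp_absorbingP[sUV sVU]; apply/mp_absorbingP.
have defGU : GU = AU - BU *m (mpinv DU *m CU) by rewrite mulmxA.
split; last first.
  rewrite defGU in sXG *.
  by apply: (submx_schur _ sVU _ sXG); rewrite mulmxA sCD.
(* Transposing swaps the off-diagonal blocks, so [submx_schur] now applies with [(BV *m mpinv DV)^T]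
   as [X] and [(mpinv DU *m CU)^T] as [Y]. *)
have defGUT : GU^T = AU^T - (mpinv DU *m CU)^T *m BU^T.
  by rewrite defGU linearB -trmx_mul.
have defGVT : GV^T = AV^T - CV^T *m (BV *m mpinv DV)^T.
  by rewrite linearB -trmx_mul.
move: sUV sYG; rewrite /range_sub !tr_block_mx defGUT defGVT => sUV sYG.
by apply: (submx_schur _ sUV _ sYG); rewrite -trmx_mul -mulmxA sBD.
Qed.

End AbsorbingPairs.

Theorem theorem4p3 (R : realType) (m n p s : nat)
    (AU AV : 'M[R[i]]_(m, n)) (BU BV : 'M[R[i]]_(m, p))
    (CU CV : 'M[R[i]]_(s, n)) (DU DV : 'M[R[i]]_(s, p)) :
  let U : 'M[R[i]]_(m + s, n + p) := block_mx AU BU CU DU in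
  let V : 'M[R[i]]_(m + s, n + p) := block_mx AV BV CV DV in
  let GU : 'M[R[i]]_(m, n) := AU - BU *m mpinv DU *m CU in
  let GV : 'M[R[i]]_(m, n) := AV - BV *m mpinv DV *m CV in
  range_sub CU DU ->
  range_sub ((mpinv DU *m CU) ^t*) (GU ^t*) ->
  range_sub (BV ^t*) (DV ^t*) ->
  range_sub (BV *m mpinv DV) GV ->
  mp_absorbing U V ->
  mp_absorbing GU GV.
Proof. exact: mp_absorbing_schur. Qed.
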